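(* The problem of deciding whether a graph $G$ has a bipartizing matching can be solved in polynomial time when $G$ is $P_5$-free (contains no induced path on $5$ vertices).
   Context: A matching $M\subseteq E(G)$ is a bipartizing matching of $G$ if the graph $(V(G),E(G)\setminus M)$ is bipartite. *)

(* Defs.v *)
From mathcomp Require Import all_boot.
Set Implicit Arguments. Unset Strict Implicit. Unset Printing Implicit Defensive.

Definition simple_graph (T : finType) (e : rel T) : Prop :=
  symmetric e /\ irreflexive e.

Definition is_matching (T : finType) (e : rel T) (M : {set {set T}}) : Prop :=
  (forall E, E \in M -> exists x y, e x y /\ E = [set x; y]) /\
  (forall E F, E \in M -> F \in M -> E != F -> [disjoint E & F]).

Definition bipartite_minus (T : finType) (e : rel T) (M : {set {set T}}) : Prop :=
  exists c : T -> bool, forall x y, e x y -> [set x; y] \notin M -> c x != c y.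

Definition bipartizing_matching (T : finType) (e : rel T) (M : {set {set T}}) : Prop :=
  is_matching e M /\ bipartite_minus e M.

Definition has_bipartizing_matching (T : finType) (e : rel T) : Prop :=
  exists M, bipartizing_matching e M.

Definition has_induced_P5 (T : finType) (e : rel T) : Prop :=
  exists f : 'I_5 -> T, injective f /\
    forall i j : 'I_5, e (f i) (f j) <-> (j == i.+1 :> nat) || (i == j.+1 :> nat).

Definition P5_free (T : finType) (e : rel T) : Prop := ~ has_induced_P5 e.

Inductive move := MoveL | MoveR | Stay.

Record TM := {
  tm_state : finType;
  tm_sym   : finType;
  tm_blank : tm_sym;
  tm_inp   : bool -> tm_sym;
  tm_start : tm_state;
  tm_acc   : tm_state;
  tm_rej   : tm_state;
  tm_delta : tm_state -> tm_sym -> tm_state * tm_sym * move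
}.

Definition wf_TM (M : TM) : Prop :=
  injective (tm_inp M) /\ (forall b, tm_inp M b != tm_blank M) /\ tm_acc M != tm_rej M.

(* configuration: state, left part (reversed, nearest first), head symbol, right part *)
Definition config (M : TM) : Type :=
  (tm_state M * seq (tm_sym M) * tm_sym M * seq (tm_sym M))%type.

Definition halted (M : TM) (q : tm_state M) : bool := (q == tm_acc M) || (q == tm_rej M).

Definition tm_step (M : TM) (c : config M) : config M :=
  let: (q, l, h, r) := c in
  if halted q then c else
  let: (q', s, mv) := tm_delta q h in
  match mv with
  | Stay => (q', l, s, r)
  | MoveL => match l with
             | [::] => (q', [::], tm_blank M, s :: r)
             | a :: l' => (q', l', a, s :: r)
             end
  | MoveR => match r with
             | [::] => (q', s :: l, tm_blank M, [::])
             | a :: r' => (q', s :: l, a, r')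
             end
  end.

Definition init_config (M : TM) (w : seq bool) : config M :=
  match w with
  | [::] => (tm_start M, [::], tm_blank M, [::])
  | b :: w' => (tm_start M, [::], tm_inp M b, map (tm_inp M) w')
  end.

(* M, on input w, halts within t steps (halted configurations are fixed by
   tm_step), and it accepts iff P holds. *)
Definition decides_within (M : TM) (w : seq bool) (t : nat) (P : Prop) : Prop :=
  let: (q, _, _, _) := iter t (@tm_step M) (init_config M w) in
  halted q /\ ((q == tm_acc M) <-> P).

Definition encode_graph (n : nat) (e : rel 'I_n) : seq bool :=
  [seq e i j | i <- enum 'I_n, j <- enum 'I_n].

(* Main.v *)
Require Import Defs.
From Stdlib Require Import FunctionalExtensionality.
From mathcomp Require Import all_boot zify.
Set Implicit Arguments. Unset Strict Implicit. Unset Printing Implicit Defensive.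

(** A bipartizing matching is the same as a 2-colouring in which every vertex
    has at most one neighbour of its own colour, so a graph having one contains
    no K5. By the theorem of Bacsó and Tuza, a component of a P5-free graph with
    at least two vertices has a dominating clique or a dominating induced P3,
    here therefore a dominating set of at most four vertices. Guessing these
    vertices, their colours and their neighbours of the same colour forces the
    colour of every other vertex of the component. Hence, on P5-free graphs, the
    property is expressed by a fixed prenex first-order sentence with 16
    quantifiers.

    Such a sentence is evaluated by a Turing machine that only sweeps over the
    adjacency matrix. The value x of a variable is stored by marking all cells
    of row x and all cells of column x: going from x to x+1 takes one sweep per
    mark, and all atoms x ~ y and x = y are read off in a single sweep. Nested
    loops then take polynomially many sweeps. *)

(** * Dominating cliques and P3s in P5-free graphs *)

Definition defective_coloring (T : finType) (e : rel T) (c : T -> bool) : Prop :=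
  forall u v w, e u v -> e u w -> c u = c v -> c u = c w -> v = w.

Section Graph.
Variables (T : finType) (e : rel T).
Hypotheses (esym : symmetric e) (eirr : irreflexive e).

Lemma edge_neq x y : e x y -> x != y.
Proof. by move=> exy; apply/eqP=> xy; rewrite xy eirr in exy. Qed.

(** Edges with equally coloured ends must all belong to the matching; conversely, these edges form a
    matching as soon as every vertex meets at most one of them. *)
Lemma bipartizing_matchingP :
  has_bipartizing_matching e <-> exists c, defective_coloring e c.
Proof.
split=> [[M [[_ disjM] [c cP]]]|[c cP]].
  exists c => u v w euv euw cuv cuw.
  have inM x : e u x -> c u = c x -> [set u; x] \in M.
    by move=> eux cux; apply: contraT => /(cP _ _ eux); rewrite cux eqxx.
  have [eqE|neqE] := eqVneq [set u; v] [set u; w].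
    have : v \in [set u; w] by rewrite -eqE !inE eqxx orbT.
    by rewrite !inE eq_sym (negPf (edge_neq euv)) => /eqP.
  have := disjM _ _ (inM _ euv cuv) (inM _ euw cuw) neqE.
  by rewrite disjoint_subset => /subsetP/(_ u); rewrite !inE eqxx => /(_ isT).
exists [set [set x.1; x.2] | x in [pred x : T * T | e x.1 x.2 && (c x.1 == c x.2)]].
split; first split.
- by move=> E /imsetP[[x y] /andP[/= exy _] ->]; exists x, y.
- move=> E F /imsetP[[x y] /andP[/= exy /eqP cxy] ->].
  move=> /imsetP[[z t] /andP[/= ezt /eqP czt] ->].
  rewrite disjoint_subset; apply: contraNT => /subsetPn[u].
  rewrite !inE negbK => /orP[] /eqP-> /orP[] /eqP eqz; subst.
  + by rewrite (cP _ _ _ exy ezt).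
  + rewrite esym in ezt; rewrite (cP _ _ _ exy ezt) //.
    by rewrite setUC.
  + rewrite esym in exy; rewrite (cP _ _ _ exy ezt) //.
    by rewrite setUC.
  + by rewrite esym in exy; rewrite esym in ezt; rewrite (cP _ _ _ exy ezt).
- exists c => x y exy; apply: contraNneq => cxy; apply/imsetP.
  by exists (x, y); rewrite // inE /= exy cxy eqxx.
Qed.

Hypothesis P5f : P5_free e.

(** Distinctness comes from the adjacencies: two of the five vertices are adjacent or are separated
    by a third one that sees exactly one of them. *)
Lemma no_induced_P5 a b c d f :
  e a b -> e b c -> e c d -> e d f ->
  e a c = false -> e a d = false -> e a f = false ->
  e b d = false -> e b f = false -> e c f = false -> False.
Proof.
move=> ab bc cd df ac ad af bd bf cf; apply: P5f.
pose s := [:: a; b; c; d; f]; exists (fun i : 'I_5 => nth a s i).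
have U : uniq s.
  have N x y z : e x z -> e y z = false -> x != y.
    by move=> exz eyz; apply: contraFneq eyz => <-.
  have N' x y z : e y z -> e x z = false -> x != y.
    by rewrite eq_sym; apply: N.
  rewrite /= !inE !negb_or (edge_neq ab) (edge_neq bc) (edge_neq cd) (edge_neq df).
  rewrite (N' _ _ _ cd ad) (N' _ _ _ df af) (N' _ _ _ df bf).
  have cb := bc; rewrite esym in cb.
  have fb := bf; rewrite esym in fb; have fc := cf; rewrite esym in fc.
  by rewrite (N _ _ _ ab fb) (N _ _ _ bc fc) (N _ _ _ cb fb).
split=> [i j /eqP|].
  by rewrite (nth_uniq a _ _ U) // => /eqP/val_inj.
have H := (ab, bc, cd, df, ac, ad, af, (bd, bf, cf)).
by case=> [[|[|[|[|[|//]]]]] /= _] [[|[|[|[|[|//]]]]] /= _];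
  rewrite /= ?eirr ?H // esym H.
Qed.

Local Ltac p5 a b c d f :=
  apply: (@no_induced_P5 a b c d f); first [done | by rewrite esym].

(** The open neighbourhood: a member of [D] belongs to it only through a neighbour in [D]. *)
Definition tnbr (D : {set T}) := [set x | [exists d in D, e x d]].

Lemma tnbrP (D : {set T}) x : reflect (exists2 d, d \in D & e x d) (x \in tnbr D).
Proof. by rewrite inE; apply: exists_inP. Qed.

Definition clique (D : {set T}) := forall x y, x \in D -> y \in D -> x != y -> e x y.

(** The clique must contain an edge, so that in both cases [D] lies in its own open
    neighbourhood. *)
Definition clique_or_P3 (D : {set T}) :=
  (clique D /\ exists x y, [/\ x \in D, y \in D & e x y]) \/
  exists a b c, [/\ D = [set a; b; c], e a b, e b c & e a c = false].

Lemma tnbr3 a b c x : (x \in tnbr [set a; b; c]) = [|| e x a, e x b | e x c].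
Proof.
apply/tnbrP/or3P=> [[d]|].
  by rewrite !inE -orbA => /or3P[] /eqP->; [constructor 1|constructor 2|constructor 3].
by case=> H; [exists a|exists b|exists c] => //; rewrite !inE eqxx ?orbT.
Qed.

Lemma clique3 a b c : e a b -> e b c -> e a c -> clique_or_P3 [set a; b; c].
Proof.
move=> ab bc ac; left; split; last by exists a, b; rewrite !inE !eqxx ?orbT.
have ba := ab; have cb := bc; have ca := ac.
rewrite esym in ba; rewrite esym in cb; rewrite esym in ca.
by move=> x y; rewrite !inE -!orbA => /or3P[] /eqP-> /or3P[] /eqP->; rewrite ?eqxx.
Qed.

Lemma P3_of a b c : e a b -> e b c -> e a c = false -> clique_or_P3 [set a; b; c].
Proof. by move=> ab bc ac; right; exists a, b, c. Qed.

(** When [v] is not dominated by [D], passing to [D'] strictly decreases the number of undominated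
    vertices. *)
Definition extends (D D' : {set T}) v :=
  [/\ clique_or_P3 D', v \in tnbr D' & tnbr D \subset tnbr D'].

(** The first candidate is [w] with its neighbours in [D]. If it loses a vertex [u0], then [u0] is
    adjacent to [v], and the induced path [v - w - a] is taken instead; a vertex lost by that path
    would produce an induced P5. *)
Lemma extend_clique (D : {set T}) v w : clique D -> w \in tnbr D -> v \notin tnbr D -> e v w ->
  exists D', extends D D' v.
Proof.
move=> cD /tnbrP[a aD wa] vD vw.
have wv : e w v by rewrite esym.
have nv x : x \in D -> e x v = false.
  by move=> xD; apply: contraNF vD => xv; apply/tnbrP; exists x; rewrite // esym.
have aw : e a w by rewrite esym.
pose A := [set x in D | e w x].
have [sub|/subsetPn[u0 u0D u0n]] := boolP (tnbr D \subset tnbr (w |: A)).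
  exists (w |: A); split=> //; last first.
    by apply/tnbrP; exists w; rewrite ?setU11.
  left; split; last by exists w, a; rewrite !inE eqxx aD wa orbT.
  move=> x y; rewrite !inE.
  case/predU1P=> [->|/andP[xD wx]] /predU1P[->|/andP[yD wy]] //; rewrite ?eqxx //.
    by rewrite esym.
  exact: cD.
have u0w : e u0 w = false.
  by apply: contraNF u0n => H; apply/tnbrP; exists w; rewrite ?setU11.
have u0A x : x \in D -> e w x -> e u0 x = false.
  by move=> xD wx; apply: contraNF u0n => H; apply/tnbrP; exists x; rewrite ?inE ?xD ?wx ?orbT.
have /tnbrP[x0 x0D u0x0] := u0D.
have wx0 : e w x0 = false by apply: contraTF u0x0 => wx0; rewrite u0A.
have adj x y : x \in D -> y \in D -> e w x = false -> e w y -> e x y.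
  by move=> xD yD wx wy; apply: cD => //; apply: contraFneq wx => ->.
have x0w : e x0 w = false by rewrite esym.
have [u0a x0a x0v av] : [/\ e u0 a = false, e x0 a, e x0 v = false & e a v = false].
  by split; [apply: u0A|apply: adj|apply: nv|apply: nv].
have va : e v a = false by rewrite esym.
have u0v : e u0 v.
  case u0v : (e u0 v) => //; exfalso.
  by p5 u0 x0 a w v.
exists [set v; w; a]; split; first by apply: P3_of.
  by rewrite tnbr3 vw orbT.
apply/subsetP=> b bD; rewrite tnbr3.
case bv: (e b v) => //; case bw: (e b w) => //; case ba: (e b a) => //=; exfalso.
(* Every neighbour of [b] in [D] must see [w], so [b] misses [x0]. This forces the edge from [b] to
   [u0], and then the induced path [b - u0 - v - w - a]. *)
have nA x : x \in D -> e w x = false -> e b x = false.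
  move=> xD wx; case bx: (e b x) => //; exfalso.
  have xa : e x a by apply: adj.
  have xv : e x v = false by apply: nv.
  by p5 b x a w v.
have /tnbrP[x xD bx] := bD.
have wx : e w x by apply: contraTT bx => /negPf wx; rewrite nA.
have xx0 : e x x0 by rewrite esym; apply: adj.
have xu0 : e x u0 = false by rewrite esym; apply: u0A.
have xv : e x v = false by apply: nv.
have bx0 : e b x0 = false by apply: nA.
have bu0 : e b u0.
  case bu0 : (e b u0) => //; exfalso.
  by p5 b x x0 u0 v.
by p5 b u0 v w a.
Qed.

(** The cases are the adjacencies of [w] to [a], [b], [c]. A candidate avoiding [v] is tried first
    where there is one; a vertex it loses turns out to be adjacent to [v], and then an induced path
    starting with [v - w] keeps everything. If [w] sees only one end of the path, [v], [w] and the
    path form an induced P5. *)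
Lemma extend_P3 a b c v w : e a b -> e b c -> e a c = false ->
  w \in tnbr [set a; b; c] -> v \notin tnbr [set a; b; c] -> e v w ->
  exists D', extends [set a; b; c] D' v.
Proof.
move=> ab bc ac; rewrite !tnbr3 !negb_or => wD /and3P[/negPf va /negPf vb /negPf vc] vw.
have ext x y z : clique_or_P3 [set x; y; z] -> [|| e v x, e v y | e v z] ->
  (forall u, [|| e u a, e u b | e u c] -> e u x = false -> e u y = false -> e u z = false -> False) ->
  exists D', extends [set a; b; c] D' v.
  move=> sD vD H; exists [set x; y; z]; split; rewrite ?tnbr3 //.
  apply/subsetP=> u; rewrite !tnbr3 => uD.
  case ux: (e u x) => //; case uy: (e u y) => //; case uz: (e u z) => //=; exfalso.
  exact: (H u).
have dec x y z : (exists u, [/\ [|| e u a, e u b | e u c], e u x = false, e u y = false & e u z = false]) \/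
  (forall u, [|| e u a, e u b | e u c] -> e u x = false -> e u y = false -> e u z = false -> False).
  have [/existsP[u /and4P[uD /negPf ux /negPf uy /negPf uz]]|/existsPn H] :=
    boolP [exists u, [&& [|| e u a, e u b | e u c], ~~ e u x, ~~ e u y & ~~ e u z]].
    by left; exists u.
  by right=> u uD ux uy uz; have := H u; rewrite uD ux uy uz.
case wb: (e w b); case wa: (e w a); case wc: (e w c).
(* Here [w] sees all three, and both triangles on [w] and [b] are tried. If both fail, [u'] sees
   only [a] and [u] only [c] among [a], [b], [c], and both are adjacent to [v]. *)
- have [u'|U'] := dec w b c; last first.
    apply: (ext b w c); [apply: clique3 => //; by rewrite esym|by rewrite vw orbT|].
    by move=> u ? ? ? ?; apply: (U' u).
  have [u|U] := dec w b a; last first.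
    apply: (ext b w a); [apply: clique3 => //; by rewrite esym|by rewrite vw orbT|].
    by move=> x ? ? ? ?; apply: (U x).
  case: u' => u' [u'D u'w u'b u'c]; case: u => u [uD uw ub ua].
  have u'a : e u' a by move: u'D; rewrite u'b u'c !orbF.
  have uc : e u c by move: uD; rewrite ub ua.
  have uu' : e u u' by case uu': (e u u') => //; exfalso; p5 u c b a u'.
  have uv : e u v.
    case uv : (e u v) => //; exfalso; case u'v : (e u' v); first by p5 b c u u' v.
    by p5 u u' a w v.
  have u'v : e u' v by case u'v : (e u' v) => //; exfalso; p5 b a u' u v.
  apply: (ext v w b); [by apply: P3_of|by rewrite vw orbT|].
  move=> t tD tv tw tb.
  have tu' : e t c -> e t u'.
    by move=> tc; case tu': (e t u') => //; exfalso; p5 t c w v u'.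
  have tu : e t a -> e t u.
    by move=> ta; case tu: (e t u) => //; exfalso; p5 t a w v u.
  case ta: (e t a); first by have {}tu := tu ta; p5 t u v w b.
  have tc: e t c by move: tD; rewrite ta tb.
  by have {}tu' := tu' tc; p5 t u' v w b.
- have [[u0 [u0D u0w u0b u0a]]|U] := dec w b a; last first.
    apply: (ext b w a); [apply: clique3 => //; by rewrite esym|by rewrite vw orbT|].
    by move=> x ? ? ? ?; apply: (U x).
  have u0c : e u0 c by move: u0D; rewrite u0b u0a.
  have u0v : e u0 v by case u0v: (e u0 v) => //; exfalso; p5 u0 c b w v.
  apply: (ext v w b); [by apply: P3_of|by rewrite vw orbT|].
  move=> u uD uv uw ub.
  case uc: (e u c); first by p5 u c b w v.
  have ua : e u a by move: uD; rewrite ub uc !orbF.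
  have uu0 : e u u0 by case uu0: (e u u0) => //; exfalso; p5 u a b c u0.
  by p5 u u0 v w b.
- have [[u0 [u0D u0w u0b u0c]]|U] := dec w b c; last first.
    apply: (ext b w c); [apply: clique3 => //; by rewrite esym|by rewrite vw orbT|].
    by move=> x ? ? ? ?; apply: (U x).
  have u0a : e u0 a by move: u0D; rewrite u0b u0c !orbF.
  have u0v : e u0 v by case u0v: (e u0 v) => //; exfalso; p5 u0 a b w v.
  apply: (ext v w b); [by apply: P3_of|by rewrite vw orbT|].
  move=> u uD uv uw ub.
  case ua: (e u a); first by p5 u a b w v.
  have uc : e u c by move: uD; rewrite ub ua.
  have uu0 : e u u0 by case uu0: (e u u0) => //; exfalso; p5 u c b a u0.
  by p5 u u0 v w b.
- apply: (ext v w b); [by apply: P3_of|by rewrite vw orbT|].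
  move=> u uD uv uw ub.
  case ua: (e u a); first by p5 u a b w v.
  have uc : e u c by move: uD; rewrite ub ua.
  by p5 u c b w v.
- have [[u0 [u0D u0w u0a u0c]]|U] := dec w a c; last first.
    apply: (ext a w c); [apply: P3_of => //; by rewrite esym|by rewrite vw orbT|].
    by move=> x ? ? ? ?; apply: (U x).
  have u0b : e u0 b by move: u0D; rewrite u0a u0c !orbF.
  have u0v : e u0 v by case u0v: (e u0 v) => //; exfalso; p5 u0 b a w v.
  apply: (ext v w a); [by apply: P3_of|by rewrite vw orbT|].
  move=> u uD uv uw ua.
  case ub: (e u b); first by p5 u b a w v.
  have uc : e u c by move: uD; rewrite ub ua.
  have uu0 : e u u0 by case uu0: (e u u0) => //; exfalso; p5 u c b u0 v.
  by p5 u u0 v w a.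
- by exfalso; p5 v w a b c.
- by exfalso; p5 v w c b a.
- by rewrite wa wb wc in wD.
Qed.

(** Starting from the edge [st], the set is extended as long as some dominated vertex has an
    undominated neighbour. Closure under adjacency means that the whole component of [s] is
    dominated. *)
Lemma dominating_clique_or_P3 s t : e s t ->
  exists D, [/\ clique_or_P3 D, s \in tnbr D & forall x y, x \in tnbr D -> e x y -> y \in tnbr D].
Proof.
move=> st; have ts : e t s by rewrite esym.
have [D [sD sN]] : exists D, clique_or_P3 D /\ s \in tnbr D.
  exists [set s; t]; split; last by apply/tnbrP; exists t; rewrite // !inE eqxx orbT.
  left; split; last by exists s, t; rewrite !inE !eqxx orbT.
  by move=> x y; rewrite !inE => /orP[] /eqP-> /orP[] /eqP->; rewrite ?eqxx.
have [k] := ubnP #|~: tnbr D|; elim: k => // k IHk in D sD sN * => le_k.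
have [H|] := boolP [forall x in tnbr D, forall y, e x y ==> (y \in tnbr D)].
  exists D; split=> // x y xD exy.
  by move/forall_inP/(_ x xD)/forallP/(_ y)/implyP: H; apply.
rewrite negb_forall_in => /exists_inP[w wD /forallPn[v]].
rewrite negb_imply => /andP[wv vD].
have vw : e v w by rewrite esym.
have [D' [sD' vD' sub]] : exists D', extends D D' v.
  case: sD => [[cD _]|[a [b [c [eD ab bc ac]]]]]; first exact: extend_clique cD wD vD vw.
  by subst D; apply: extend_P3 ab bc ac wD vD vw.
apply: (IHk D') => //; first exact: (subsetP sub).
rewrite -ltnS (leq_trans _ le_k) // ltnS; apply: proper_card.
rewrite properE setCS sub; apply/subsetPn; exists v; first by rewrite inE.
by rewrite inE negbK.
Qed.

Lemma clique_or_P3_sub D : clique_or_P3 D -> {subset D <= tnbr D}.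
Proof.
case=> [[cD [x [y [xD yD exy]]]]|[a [b [c [-> ab bc _]]]]] z zD.
  apply/tnbrP; have [->|zx] := eqVneq z x; first by exists y.
  by exists x => //; apply: cD.
rewrite tnbr3; move: zD; rewrite !inE -orbA => /or3P[] /eqP->; rewrite ?ab ?bc ?orbT //.
by rewrite [e c b]esym bc orbT.
Qed.

(** Each of the two colours occurs at most twice in a clique: among three vertices of one colour,
    each would have two neighbours of its own colour. *)
Lemma card_clique_or_P3 c D : defective_coloring e c -> clique_or_P3 D -> #|D| <= 4.
Proof.
move=> cP [[cD _]|[x [y [z [-> _ _ _]]]]]; last first.
  by rewrite -setUA !cardsU1 cards1; case: (_ \notin _); case: (_ \notin _).
have le2 b : #|[set x in D | c x == b]| <= 2.
  rewrite leqNgt; apply/negP=> /card_gt2P[x [y [z [[]]]]].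
  rewrite !inE => /andP[xD /eqP cx] /andP[yD /eqP cy] /andP[zD /eqP cz] [xy yz zx].
  have := cP x y z; rewrite cx cy cz => /(_ (cD _ _ xD yD xy)).
  by rewrite eq_sym in zx => /(_ (cD _ _ xD zD zx) erefl erefl)/eqP; apply/negP.
rewrite -(cardsID [set x | c x] D) (@leq_trans (2 + 2)) // leq_add //.
  by apply: leq_trans (le2 true); apply/subset_leq_card/subsetP=> x; rewrite !inE eqb_id.
by apply: leq_trans (le2 false); apply/subset_leq_card/subsetP=> x; rewrite !inE eqbF_neg andbC.
Qed.

End Graph.

(** * The first-order sentence *)

(** A decision list with four guards and a default. *)
Definition first_of4 (p col : nat -> bool) (rest : bool) : bool :=
  foldr (fun k r => if p k then col k else r) rest (iota 0 4).

Lemma first_of4_eq (p col : nat -> bool) rest b :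
  (forall k, k < 4 -> p k -> col k = b) ->
  ((forall k, k < 4 -> p k = false) -> rest = b) -> first_of4 p col rest = b.
Proof.
rewrite /first_of4 /= => H R.
case p0: (p 0); first exact: H.
case p1: (p 1); first exact: H.
case p2: (p 2); first exact: H.
case p3: (p 3); first exact: H.
by apply: R => -[|[|[|[|]]]].
Qed.

(* Variable 0 is a vertex s, variables 1-4 are dominators of the component of s,
   variable 5+k is the neighbour of dominator 1+k of the same colour (or that
   dominator itself), and the colour of dominator 1+k is whether variable 9+k
   equals s. Variables 13-15 test the colouring these data force. *)
Definition var_dominated (E Q : rel nat) a :=
  has (fun k => Q a k.+1 || E a k.+1) (iota 0 4).

Definition var_color (E Q : rel nat) a :=
  let col k := Q (9 + k) 0 in
  first_of4 (fun k => Q a k.+1) col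
    (first_of4 (fun k => Q a (5 + k)) col
       (first_of4 (fun k => E a k.+1) (fun k => ~~ col k) false)).

Definition color_matrix (E Q : rel nat) : bool :=
  [&& var_dominated E Q 0,
      var_dominated E Q 13 && E 13 14 ==> var_dominated E Q 14
    & ~~ [&& var_dominated E Q 13, E 13 14, E 13 15, ~~ Q 14 15,
             var_color E Q 13 == var_color E Q 14
           & var_color E Q 13 == var_color E Q 15]].

Definition matrix_at (T : finType) (e : rel T) (v : nat -> T) : bool :=
  color_matrix (fun a b => e (v a) (v b)) (fun a b => v a == v b).

(** The quantifier blocks are: for all variable 0, there exist 1 to 12, for all 13 to 15. Each block
    is one quantification over assignments that agree on the earlier variables. *)
Definition color_sentence (T : finType) (e : rel T) : Prop :=
  forall v : nat -> T, exists2 v1 : nat -> T, v1 0 = v 0 &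
  forall v2, (forall i, i < 13 -> v2 i = v1 i) -> matrix_at e v2.

Section Sentence.
Variables (T : finType) (e : rel T).
Hypotheses (esym : symmetric e) (eirr : irreflexive e).

(** For each [s] the existential witnesses determine a set containing [s] and closed under
    adjacency, and a colouring valid on it. Colourings obtained from different [s] may disagree, so
    each component uses the one of its canonical root. *)
Lemma sentence_coloring : color_sentence e -> exists c, defective_coloring e c.
Proof.
move=> Hs.
have /fin_all_exists[U] : forall s, exists Uc : (T -> bool) * (T -> bool),
    [/\ Uc.1 s, forall x y, Uc.1 x -> e x y -> Uc.1 y &
     forall u v w, Uc.1 u -> e u v -> e u w -> Uc.2 u = Uc.2 v -> Uc.2 u = Uc.2 w -> v = w].
  move=> s; have [v1 v10 Hv1] := Hs (fun=> s).
  pose v2 x y z i := if i < 13 then v1 i else nth s [:: x; y; z] (i - 13).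
  pose val x := (var_dominated (fun a b => e (v2 x s s a) (v2 x s s b)) (fun a b => v2 x s s a == v2 x s s b) 13,
     var_color (fun a b => e (v2 x s s a) (v2 x s s b)) (fun a b => v2 x s s a == v2 x s s b) 13).
  exists (fun x => (val x).1, fun x => (val x).2).
  have H x y z : matrix_at e (v2 x y z) by apply: Hv1 => i lti; rewrite /v2 lti.
  split=> /=.
  - by have /and3P[+ _ _] := H s s s; rewrite {1}/var_dominated /= /v2 /= v10.
  - move=> x y Ux exy; have /and3P[_ /implyP + _] := H x y s.
    by apply; apply/andP; split.
  - move=> x y z Ux exy exz cxy cxz; apply/eqP/negP=> /negP yz.
    have /and3P[_ _ /negP] := H x y z; apply.
    by apply/and5P; split=> //; apply/andP; split=> //; apply/eqP.
move=> HU; pose r := root e; have sc : connect_sym e by apply: sym_connect_sym.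
have inU x : (U (r x)).1 x.
  have [HUr cl _] := HU (r x).
  have /connectP[p] : connect e (r x) x by rewrite sc connect_root.
  move: (U (r x)) HUr cl => W HUr cl; elim: p (r x) HUr => [|y p IHp] z Uz /=; first by move=> _ ->.
  by case/andP=> ezy py xl; apply: (IHp y) => //; apply: cl ezy.
exists (fun x => (U (r x)).2 x) => u v w euv euw.
have rv y : e u y -> r y = r u.
  by move=> euy; symmetry; apply/(rootP sc)/connect1.
rewrite (rv v euv) (rv w euw).
by have [_ _] := HU (r u); apply.
Qed.

Lemma coloring_sentence c : P5_free e -> defective_coloring e c -> color_sentence e.
Proof.
move=> P5f cP v; set s := v 0.
have [/existsP[t st]|/existsPn iso] := boolP [exists t, e s t]; last first.
  (* For isolated [s] all existential variables take the value [s]; then only [s] is dominated, and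
     no conflict arises because [s] has no edge. *)
  exists (fun=> s) => // v2 Hv2.
  have es x : e s x = false by apply/negbTE.
  have dom a : var_dominated (fun a b => e (v2 a) (v2 b)) (fun a b => v2 a == v2 b) a = (v2 a == s).
    have es' x : e x s = false by rewrite esym.
    by rewrite /var_dominated /= (Hv2 1) // (Hv2 2) // (Hv2 3) // (Hv2 4) // !es'; case: eqP.
  rewrite /matrix_at /color_matrix !dom (Hv2 0) // eqxx /=.
  by case: eqP => //= ->; rewrite es.
have [D [sD sN clN]] := dominating_clique_or_P3 esym eirr P5f st.
have leD := card_clique_or_P3 cP sD.
have subD := clique_or_P3_sub esym sD.
have /tnbrP[d0 d0D _] := sN.
(* Indices beyond the size of [D] repeat the member [d0], so that there are always four
   dominators. *)
pose d k := nth d0 (enum D) k.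
have dD k : d k \in D.
  rewrite /d; have [lt_k|le_k] := ltnP k (size (enum D)); last by rewrite nth_default.
  by rewrite -mem_enum mem_nth.
have Dd x : x \in D -> exists2 k, k < 4 & x = d k.
  move=> xD; exists (index x (enum D)); last by rewrite /d nth_index ?mem_enum.
  by apply: leq_trans leD; rewrite cardE index_mem mem_enum.
(* A dominator without a neighbour of its own colour is its own partner, which still has the right
   colour. *)
pose p k := odflt (d k) [pick y | e (d k) y && (c (d k) == c y)].
have pP k y : e (d k) y -> c (d k) = c y -> p k = y.
  move=> dy cy; rewrite /p; case: pickP => [z /andP[dz /eqP cz]|/(_ y)] /=.
    exact: cP dz dy cz cy.
  by rewrite dy cy eqxx.
have cp k : c (p k) = c (d k).
  by rewrite /p; case: pickP => [z /andP[_ /eqP]|].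
(* A colour bit is coded by two distinct vertices: [s] stands for true and its neighbour [t] for
   false. *)
pose v1 i := if i == 0 then s else if i < 5 then d i.-1 else if i < 9 then p (i - 5)
  else if c (d (i - 9)) then s else t.
exists v1 => // v2 Hv2.
have v2d k : k < 4 -> v2 k.+1 = d k.
  by move=> lt_k; rewrite Hv2 /v1; [rewrite /= ltnS lt_k | lia].
have v2p k : k < 4 -> v2 (5 + k) = p k.
  move=> lt_k; rewrite Hv2 /v1; last by lia.
  have -> : (5 + k == 0) = false by lia.
  have -> : (5 + k < 5) = false by lia.
  have -> : (5 + k < 9) = true by lia.
  by rewrite addKn.
have v20 : v2 0 = s by rewrite Hv2.
have v2c k : k < 4 -> (v2 (9 + k) == v2 0) = c (d k).
  move=> lt_k; rewrite v20 Hv2 /v1; last by lia.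
  have -> : (9 + k == 0) = false by lia.
  have -> : (9 + k < 5) = false by lia.
  have -> : (9 + k < 9) = false by lia.
  rewrite addKn.
  by case: (c (d k)); rewrite ?eqxx // eq_sym (negPf (edge_neq eirr st)).
have dom a : var_dominated (fun a b => e (v2 a) (v2 b)) (fun a b => v2 a == v2 b) a = (v2 a \in tnbr e D).
  apply/hasP/idP=> [[k]|/tnbrP[x /Dd[k lt_k ->] ek]]; last first.
    by exists k; rewrite ?mem_iota // v2d // ek orbT.
  rewrite mem_iota /= => lt_k; rewrite v2d // => /orP[/eqP->|ed]; first by apply: subD.
  by apply/tnbrP; exists (d k).
have col a : v2 a \in tnbr e D ->
    var_color (fun a b => e (v2 a) (v2 b)) (fun a b => v2 a == v2 b) a = c (v2 a).
  move=> /tnbrP[x /Dd[j lt_j ->] ej].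
  apply: first_of4_eq => [k lt_k|nd].
    by rewrite v2c // v2d // => /eqP->.
  apply: first_of4_eq => [k lt_k|np].
    by rewrite v2c // v2p // => /eqP->; rewrite cp.
  (* The vertex is now neither a dominator nor a partner. A dominator adjacent to it has the
     opposite colour, because a neighbour of the same colour would be its partner. *)
  apply: first_of4_eq => [k lt_k|na]; last first.
    by have := na j lt_j; rewrite v2d // ej.
  rewrite v2c // v2d // => ek; have := np k lt_k; rewrite v2p //.
  have := @pP k (v2 a); rewrite esym ek => /(_ isT).
  by case: (c (d k)); case: (c (v2 a)) => // ->; rewrite ?eqxx.
apply/and3P; split.
- by rewrite dom v20.
- by apply/implyP; rewrite !dom => /andP[]; apply: clN.
- apply/negP=> /and5P[]; rewrite dom => d13 e14 e15 n /andP[].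
  rewrite !col // ?(clN _ _ d13) // => /eqP c14 /eqP c15.
  by rewrite (cP _ _ _ e14 e15 c14 c15) eqxx in n.
Qed.

End Sentence.

Theorem color_sentenceP (T : finType) (e : rel T) : simple_graph e -> P5_free e ->
  color_sentence e <-> has_bipartizing_matching e.
Proof.
move=> [esym eirr] P5f; rewrite bipartizing_matchingP //; split.
  exact: sentence_coloring.
by case=> c; apply: coloring_sentence.
Qed.

(** * Machine fragments made of sweeps *)

Section Fragments.
Variable S : finType.

Definition tape : Type := (seq (option S) * option S * seq (option S))%type.

(** The head is on the first cell of [r], or on a blank if the written part is exhausted; [ltape] is
    the mirror image. *)
Definition rtape (l r : seq (option S)) : tape :=
  if r is h :: r' then (l, h, r') else (l, None, [::]).

Definition ltape (l r : seq (option S)) : tape :=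
  if l is h :: l' then (l', h, r) else ([::], None, r).

Definition move_head (mv : move) l s r : tape :=
  match mv with
  | Stay => (l, s, r)
  | MoveL => ltape l (s :: r)
  | MoveR => rtape (s :: l) r
  end.

(** A fragment has two exits, the booleans in the target of [fdelta], which serve as its result. *)
Record frag := Frag {
  fstate : finType;
  fentry : fstate;
  fdelta : fstate -> option S -> (fstate + bool) * option S * move
}.

Inductive runs (F : frag) : fstate F + bool -> tape -> nat -> fstate F + bool -> tape -> Prop :=
| runs0 q tp : runs q tp 0 q tp
| runsS q l h r q' s mv t q2 tp2 : fdelta q h = (q', s, mv) ->
    runs q' (move_head mv l s r) t q2 tp2 -> runs (inl q) (l, h, r) t.+1 q2 tp2.

Lemma runs_trans F q tp t q1 tp1 t' q2 tp2 :
  @runs F q tp t q1 tp1 -> @runs F q1 tp1 t' q2 tp2 -> @runs F q tp (t + t') q2 tp2.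
Proof.
elim=> // {}q l h r q' s mv {}t q3 tp3 Hd _ IH H.
by apply: runsS Hd (IH H).
Qed.

(** A simulation in which [phi] may send the exits of [A] to any state of [G]; this covers the ways
    of composing fragments below. *)
Lemma runs_embed A G (phi : fstate A + bool -> fstate G + bool) (f : fstate A -> fstate G) :
  (forall a, phi (inl a) = inl (f a)) ->
  (forall a h q s mv, fdelta a h = (q, s, mv) -> fdelta (f a) h = (phi q, s, mv)) ->
  forall q tp t q2 tp2, @runs A q tp t q2 tp2 -> @runs G (phi q) tp t (phi q2) tp2.
Proof.
move=> Hf Hd q tp t q2 tp2; elim=> [*|{}q l h r q' s mv {}t q3 tp3 E _ IH].
  exact: runs0.
by rewrite Hf; apply: runsS (Hd _ _ _ _ _ E) IH.
Qed.

(** The transition that leaves [A] enters the next fragment directly, so running times simply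
    add. *)
Definition ite (A B C : frag) : frag :=
  @Frag (fstate A + (fstate B + fstate C))%type (inl (fentry A))
    (fun q h => match q with
     | inl a => let: (q', s, mv) := fdelta a h in
        (match q' with
         | inl a' => inl (inl a')
         | inr true => inl (inr (inl (fentry B)))
         | inr false => inl (inr (inr (fentry C)))
         end, s, mv)
     | inr (inl b) => let: (q', s, mv) := fdelta b h in
        (match q' with inl b' => inl (inr (inl b')) | inr x => inr x end, s, mv)
     | inr (inr c) => let: (q', s, mv) := fdelta c h in
        (match q' with inl c' => inl (inr (inr c')) | inr x => inr x end, s, mv)
     end).

Definition seqf A B := ite A B B.

(* Repeats [C; D]: stops with result [pol] as soon as [C] returns [pol], and
   with the opposite result as soon as [D] returns [false]. *)
Definition search (pol : bool) (C D : frag) : frag :=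
  @Frag (fstate C + fstate D)%type (inl (fentry C))
    (fun q h => match q with
     | inl c => let: (q', s, mv) := fdelta c h in
        (match q' with
         | inl c' => inl (inl c')
         | inr b => if b == pol then inr pol else inl (inr (fentry D))
         end, s, mv)
     | inr d => let: (q', s, mv) := fdelta d h in
        (match q' with
         | inl d' => inl (inr d')
         | inr b => if b then inl (inl (fentry C)) else inr (~~ pol)
         end, s, mv)
     end).

Definition result F tp T tp' b :=
  exists2 t, t <= T & @runs F (inl (fentry F)) tp t (inr b) tp'.

Lemma result_ite A B C tp T tp1 b T' tp2 b' :
  result A tp T tp1 b -> result (if b then B else C) tp1 T' tp2 b' ->
  result (ite A B C) tp (T + T') tp2 b'.
Proof.
move=> [t le_t rA] [t' le_t' rB]; exists (t + t'); first exact: leq_add.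
pose phiA (q : fstate A + bool) : fstate (ite A B C) + bool := match q with
  | inl a' => inl (inl a')
  | inr true => inl (inr (inl (fentry B)))
  | inr false => inl (inr (inr (fentry C))) end.
have HA : @runs (ite A B C) (phiA (inl (fentry A))) tp t (phiA (inr b)) tp1.
  by apply: (@runs_embed A (ite A B C) phiA inl) rA => // a h q s mv /= ->.
apply: runs_trans HA _; case: b {rA} rB => rB.
  pose phiB (q : fstate B + bool) : fstate (ite A B C) + bool := match q with
    | inl a' => inl (inr (inl a')) | inr x => inr x end.
  by apply: (@runs_embed B (ite A B C) phiB (fun b => inr (inl b))) rB => // a h q s mv /= ->.
pose phiC (q : fstate C + bool) : fstate (ite A B C) + bool := match q with
  | inl a' => inl (inr (inr a')) | inr x => inr x end.
by apply: (@runs_embed C (ite A B C) phiC (fun b => inr (inr b))) rB => // a h q s mv /= ->.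
Qed.

Section Search.
Variables (pol : bool) (C D : frag).
Let phiC (q : fstate C + bool) : fstate (search pol C D) + bool := match q with
  | inl c => inl (inl c)
  | inr b => if b == pol then inr pol else inl (inr (fentry D)) end.
Let phiD (q : fstate D + bool) : fstate (search pol C D) + bool := match q with
  | inl c => inl (inr c)
  | inr b => if b then inl (inl (fentry C)) else inr (~~ pol) end.

Let runsC q tp t q2 tp2 : @runs C q tp t q2 tp2 -> runs (phiC q) tp t (phiC q2) tp2.
Proof.
by apply: (@runs_embed C (search pol C D) phiC inl) => // a h {}q s mv /= ->.
Qed.

Let runsD q tp t q2 tp2 : @runs D q tp t q2 tp2 -> runs (phiD q) tp t (phiD q2) tp2.
Proof.
by apply: (@runs_embed D (search pol C D) phiD inr) => // a h {}q s mv /= ->.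
Qed.

Let neg_pol : (~~ pol == pol) = false. Proof. by case: (pol). Qed.

Lemma search_stop tp T tp1 : result C tp T tp1 pol -> result (search pol C D) tp T tp1 pol.
Proof. by case=> t le_t /runsC; rewrite /phiC eqxx; exists t. Qed.

Lemma search_end tp T tp1 T' tp2 : result C tp T tp1 (~~ pol) ->
  result D tp1 T' tp2 false -> result (search pol C D) tp (T + T') tp2 (~~ pol).
Proof.
case=> t le_t /runsC HC [t' le_t' /runsD HD]; exists (t + t'); first exact: leq_add.
by move: HC; rewrite {2}/phiC neg_pol => HC; apply: runs_trans HC HD.
Qed.

Lemma search_next tp T tp1 T' tp2 T'' tp3 b : result C tp T tp1 (~~ pol) ->
  result D tp1 T' tp2 true -> result (search pol C D) tp2 T'' tp3 b ->
  result (search pol C D) tp (T + T' + T'') tp3 b.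
Proof.
case=> t le_t /runsC HC [t' le_t' /runsD HD] [t2 le_t2 H].
exists (t + t' + t2); first by rewrite !leq_add.
apply: runs_trans H; move: HC; rewrite {2}/phiC neg_pol => HC.
exact: runs_trans HC HD.
Qed.
End Search.

(** * Sweeps over the word *)

Section Pass.
Variables (Q : finType) (U : Q -> S -> Q) (W : Q -> S -> S) (out : Q -> bool) (q0 : Q).

(* [None] leaves the blank left of the word, [Some (inl q)] scans it rightwards
   in state [q], and [Some (inr b)] returns to that blank with result [b]. *)
Definition pass_from (entry : option (Q + bool)) : frag :=
  @Frag (option (Q + bool)) entry
    (fun q h => match q, h with
     | None, _ => (inl (Some (inl q0)), h, MoveR)
     | Some (inl q), Some s => (inl (Some (inl (U q s))), Some (W q s), MoveR)
     | Some (inl q), None => (inl (Some (inr (out q))), None, MoveL)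
     | Some (inr b), Some s => (inl (Some (inr b)), Some s, MoveL)
     | Some (inr b), None => (inr b, None, Stay)
     end).

Definition pass := pass_from None.
Definition startup := pass_from (Some (inl q0)).

Fixpoint mealy (q : Q) (w : seq S) : Q * seq S :=
  if w is s :: w' then let: (q', w2) := mealy (U q s) w' in (q', W q s :: w2) else (q, [::]).

(** The form of the tape between fragments: head on the blank left of the word, exactly one blank
    after it. *)
Definition canon (w : seq S) : tape := ([::], None, map Some w ++ [:: None]).

(** The states are given in advance by [st], which turns the recursive run into a cellwise
    formula. *)
Lemma mealyE (X : nat -> S) (st : nat -> Q) N : (forall i, i < N -> st i.+1 = U (st i) (X i)) ->
  mealy (st 0) (mkseq X N) = (st N, mkseq (fun i => W (st i) (X i)) N).
Proof.
rewrite /mkseq => H.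
have {H}: forall i, 0 <= i < 0 + N -> st i.+1 = U (st i) (X i) by move=> i; apply: H.
rewrite -{3}[N]add0n; elim: N 0 => [|N IH] m H /=; first by rewrite addn0.
by rewrite -H ?IH ?addSnnS //; [move=> i Hi; apply: H | ]; lia.
Qed.

Lemma scan_runs entry l w R q q' w' : mealy q w = (q', w') ->
  @runs (pass_from entry) (inl (Some (inl q))) (rtape l (map Some w ++ R)) (size w)
    (inl (Some (inl q'))) (rtape (rev (map Some w') ++ l) R).
Proof.
elim: w l q q' w' => [|s w IH] l q q' w' /=; first by case=> <- <-; apply: runs0.
case E: (mealy (U q s) w) => [q1 w1] [<- <-].
apply: (@runsS (pass_from entry)); first reflexivity.
by rewrite /= rev_cons cat_rcons; apply: IH.
Qed.

Lemma rewind_runs entry L w R b :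
  @runs (pass_from entry) (inl (Some (inr b))) (ltape (rev (map Some w) ++ L) R) (size w)
    (inl (Some (inr b))) (ltape L (map Some w ++ R)).
Proof.
elim/last_ind: w R => [|w s IH] R; first exact: runs0.
rewrite map_rcons rev_rcons size_rcons /=.
apply: (@runsS (pass_from entry)); first reflexivity.
by rewrite cat_rcons; apply: IH.
Qed.

(* The scan may start with nothing or with a single blank on either side; it
   always ends with exactly one blank after the word and the head before it. *)
Lemma scan_rewind entry L w R q q' w' : mealy q w = (q', w') ->
  L \in [:: [::]; [:: None]] -> R \in [:: [::]; [:: None]] ->
  @runs (pass_from entry) (inl (Some (inl q))) (rtape L (map Some w ++ R)) (2 * size w).+2
    (inr (out q')) (canon w').
Proof.
move=> E HL HR.
have sw : size w' = size w.
  elim: w q q' w' E {HL HR} => [|s w IH] q q' w' /=; first by case=> _ <-.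
  by case E: mealy => [q1 w1] [_ <-] /=; rewrite (IH _ _ _ E).
have -> : (2 * size w).+2 = size w + (1 + (size w' + 1)) by lia.
apply: runs_trans (scan_runs _ _ _ E) _.
have -> l : rtape l R = (l, None, [::]) by move: HR; rewrite !inE => /orP[] /eqP->.
apply: runs_trans.
  apply: (@runsS (pass_from entry)); [reflexivity | exact: runs0].
apply: runs_trans (rewind_runs _ _ _ _ _) _.
have -> r : ltape L r = ([::], None, r) by move: HL; rewrite !inE => /orP[] /eqP->.
apply: (@runsS (pass_from entry)); [reflexivity | exact: runs0].
Qed.

Lemma result_pass w q w' : mealy q0 w = (q, w') ->
  result pass (canon w) (2 * size w + 3) (canon w') (out q).
Proof.
move=> E; exists (1 + (2 * size w).+2); first by lia.
apply: (@runs_trans pass _ _ _ (inl (Some (inl q0))) (rtape [:: None] (map Some w ++ [:: None]))).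
  apply: (@runsS pass); [reflexivity | exact: runs0].
exact: scan_rewind E _ _.
Qed.

(** The initial tape has no blanks around the word; this first sweep brings it into the form
    [canon]. *)
Lemma result_startup w q w' : mealy q0 w = (q, w') ->
  result startup (rtape [::] (map Some w)) (2 * size w + 3) (canon w') (out q).
Proof.
move=> E; exists (2 * size w).+2; first by lia.
by have := @scan_rewind (Some (inl q0)) [::] w [::] _ _ _ E; rewrite cats0; apply.
Qed.
End Pass.

(** Total correctness with time bound [T] between tapes in canonical form. Words are functions on
    [nat], of which only the first [N] values reach the tape. *)
Definition wp N F T (Post : (nat -> S) -> bool -> Prop) (X : nat -> S) : Prop :=
  exists X' b, result F (canon (mkseq X N)) T (canon (mkseq X' N)) b /\ Post X' b.

Lemma wp_weaken N F T T' (P P' : (nat -> S) -> bool -> Prop) X :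
  wp N F T P X -> T <= T' -> (forall X' b, P X' b -> P' X' b) -> wp N F T' P' X.
Proof.
move=> [X' [b [[t le_t r] p]]] le_T HP; exists X', b; split; last exact: HP.
by exists t => //; apply: leq_trans le_T.
Qed.

Lemma wp_ite N A B C T T' P X :
  wp N A T (fun X' b => wp N (if b then B else C) T' P X') X -> wp N (ite A B C) (T + T') P X.
Proof.
move=> [X' [b [rA [X2 [b2 [rB p]]]]]]; exists X2, b2; split=> //.
exact: result_ite rA rB.
Qed.

Lemma wp_seq N A B T T' P X :
  wp N A T (fun X' _ => wp N B T' P X') X -> wp N (seqf A B) (T + T') P X.
Proof. by move=> H; apply: wp_ite; apply: wp_weaken H _ _ => // X' []. Qed.

(** The loop rule: [I i] holds before round [i], and [J i] after its run of [C], whose result is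
    [res i]; [D] prepares the next round and returns [false] after round [K]. Polarity [true] gives
    an existential search, [false] a universal one. *)
Lemma wp_search N pol C D K Tc Td (I J : nat -> (nat -> S) -> Prop) (res : nat -> bool) J' X :
  (forall i X, i <= K -> I i X -> wp N C Tc (fun X' b => J i X' /\ b = res i) X) ->
  (forall i X, i <= K -> res i = ~~ pol -> J i X ->
     wp N D Td (fun X' b => b = (i < K) /\ if i < K then I i.+1 X' else J' X') X) ->
  I 0 X ->
  wp N (search pol C D) (K.+1 * (Tc + Td)) (fun X' b =>
    if b == pol then exists i, [/\ i <= K, res i = pol & J i X']
    else (forall i, i <= K -> res i = ~~ pol) /\ J' X') X.
Proof.
move=> HC HD I0.
suff gen i Y : i <= K -> (forall j, j < i -> res j = ~~ pol) -> I i Y ->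
  wp N (search pol C D) ((K - i).+1 * (Tc + Td)) (fun X' b =>
    if b == pol then exists i, [/\ i <= K, res i = pol & J i X']
    else (forall i, i <= K -> res i = ~~ pol) /\ J' X') Y.
  by have := gen 0 X; rewrite subn0; apply.
move: Y => {I0} {}X le_i Hi Ii.
have [d] := ubnP (K - i); elim: d => // d IH in i X le_i Hi Ii *; rewrite ltnS => le_d.
have [X1 [b [rC [Ji eb]]]] := HC _ _ le_i Ii; rewrite {}eb in rC.
have [ri|ri] := eqVneq (res i) pol.
  exists X1, pol; split; last by rewrite eqxx; exists i.
  rewrite ri in rC; have [t le_t r] := search_stop D rC.
  by exists t => //; rewrite mulSn -addnA (leq_trans le_t) // leq_addr.
have {}ri : res i = ~~ pol by move: ri; case: (res i); case: (pol).
have [X2 [b2 [rD [eb2 HX2]]]] := HD _ _ le_i ri Ji; rewrite {}eb2 in rD; rewrite ri in rC.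
case: ltnP HX2 rD => [lt_i|ge_i] HX2 rD.
  have Hi' j : j < i.+1 -> res j = ~~ pol.
    by rewrite ltnS leq_eqVlt => /predU1P[->|/Hi].
  have [|X3 [b3 [r3 P3]]] := IH _ _ lt_i Hi' HX2; first by lia.
  exists X3, b3; split=> //; have [t le_t r] := search_next rC rD r3.
  exists t => //; apply: leq_trans le_t _.
  have -> : K - i = (K - i.+1).+1 by lia.
  by rewrite [leqRHS]mulSn.
exists X2, (~~ pol); split.
  have [t le_t r] := search_end rC rD.
  by exists t => //; rewrite mulSn (leq_trans le_t) // leq_addr.
have -> : (~~ pol == pol) = false by case: (pol).
split=> // j; rewrite leq_eqVlt => /predU1P[->|lt_j]; last by apply: Hi; apply: leq_trans ge_i.
by rewrite (_ : K = i) //; apply/eqP; rewrite eqn_leq le_i ge_i.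
Qed.

Lemma wp_pass N (Q : finType) (U : Q -> S -> Q) W out q0 (st : nat -> Q) (P : (nat -> S) -> bool -> Prop) X :
  st 0 = q0 -> (forall i, i < N -> st i.+1 = U (st i) (X i)) ->
  P (fun i => W (st i) (X i)) (out (st N)) ->
  wp N (pass U W out q0) (2 * N + 3) P X.
Proof.
move=> <- Hst HP; exists (fun i => W (st i) (X i)), (out (st N)); split=> //.
by have := result_pass out (mealyE W Hst); rewrite size_mkseq.
Qed.

End Fragments.

(** * Evaluating a prenex sentence by sweeps *)

Lemma has_iota_eq (p : pred nat) (N j : nat) (b : bool) :
  (forall i, i < N -> p i = (i == j) && b) -> has p (iota 0 N) = (j < N) && b.
Proof.
move=> H; apply/hasP/andP=> [[i]|[lt_j bt]].
  by rewrite mem_iota /= => lt_i; rewrite H // => /andP[/eqP <-].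
by exists j; rewrite ?mem_iota // H // eqxx.
Qed.

Section Tracks.
Variable m' : nat.
Notation m := m'.+1.

(** A cell is a stack of bits: six auxiliary tracks, then a row track and a column track for each of
    the [m] variables. *)
Definition track : finType := ('I_6 + 'I_m * bool)%type.
Definition cell : finType := {ffun track -> bool}.

Definition tIn : track := inl (@Ordinal 6 0 isT).
Definition tEnd : track := inl (@Ordinal 6 1 isT).
Definition tP : track := inl (@Ordinal 6 2 isT).
Definition tA : track := inl (@Ordinal 6 3 isT).
Definition tB : track := inl (@Ordinal 6 4 isT).
Definition tC : track := inl (@Ordinal 6 5 isT).
Definition trow (k : nat) : track := inr (inord k, true).
Definition tcol (k : nat) : track := inr (inord k, false).

Definition upd (s : cell) (t : track) (b : bool) : cell :=
  [ffun u => if u == t then b else s u].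

Definition write (t : track) (b0 : bool) (U G : bool -> cell -> bool) : frag cell :=
  pass U (fun b s => upd s t (G b s)) id b0.

(** The control bit remembers [F] of the previous cell, so the track receives [F] moved one cell to
    the right. *)
Definition shift t (F : cell -> bool) b0 := write t b0 (fun _ => F) (fun b _ => b).
Definition set_track t (F : cell -> bool) := write t false (fun b _ => b) (fun _ => F).
(** The control bit changes only at row ends, so a whole row receives the value of [F] at the end of
    the previous row. *)
Definition shift_rows t (F : cell -> bool) b0 :=
  write t b0 (fun b s => if s tEnd then F s else b) (fun b _ => b).
Definition test (F : cell -> bool) : frag cell :=
  pass (fun b s => b || F s) (fun _ s => s) id false.
Definition const (b : bool) : frag cell := pass (fun b _ => b) (fun _ s => s) id b.

Definition pass_time N := 2 * N + 3.

Implicit Types (X : nat -> cell) (P : (nat -> cell) -> bool -> Prop).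

Lemma wp_write N t b0 U G (st : nat -> bool) P X :
  st 0 = b0 -> (forall i, i < N -> st i.+1 = U (st i) (X i)) ->
  (forall X', (forall i, X' i t = G (st i) (X i)) ->
     (forall i u, u != t -> X' i u = X i u) -> P X' (st N)) ->
  wp N (write t b0 U G) (pass_time N) P X.
Proof.
move=> st0 Hst HP; apply: (wp_pass st0 Hst); apply: HP => [i|i u nu].
  by rewrite ffunE eqxx.
by rewrite ffunE (negPf nu).
Qed.

Lemma wp_shift N t F b0 P X :
  (forall X' b, (forall i, X' i t = if i is j.+1 then F (X j) else b0) ->
     (forall i u, u != t -> X' i u = X i u) -> P X' b) ->
  wp N (shift t F b0) (pass_time N) P X.
Proof.
move=> HP; apply: (@wp_write N t b0 _ _ (fun i => if i is j.+1 then F (X j) else b0)) => //.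
by move=> X' H1 H2; apply: HP.
Qed.

Lemma wp_set N t F P X :
  (forall X' b, (forall i, X' i t = F (X i)) ->
     (forall i u, u != t -> X' i u = X i u) -> P X' b) ->
  wp N (set_track t F) (pass_time N) P X.
Proof.
by move=> HP; apply: (@wp_write N t false _ _ (fun=> false)) => // X' H1 H2; apply: HP.
Qed.

Lemma wp_shift_rows N n t F b0 P X : 0 < n ->
  (forall i, i < N -> X i tEnd = (n %| i.+1)) ->
  (forall X' b, (forall i, X' i t = if i %/ n is r.+1 then F (X (r.+1 * n).-1) else b0) ->
     (forall i u, u != t -> X' i u = X i u) -> P X' b) ->
  wp N (shift_rows t F b0) (pass_time N) P X.
Proof.
move=> n0 HE HP.
apply: (@wp_write N t b0 _ _ (fun i => if i %/ n is r.+1 then F (X (r.+1 * n).-1) else b0)).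
- by rewrite div0n.
(* When [n] divides [i.+1], cell [i] is the last of its row, which is the cell named by the formula
   for the next row. *)
- move=> i lt_i; rewrite HE // divnS //; case: ifP => [dv|_]; last by rewrite add0n.
  by rewrite add1n -add1n -[1]/(true : nat) -dv -divnS // divnK.
- by move=> X' H1 H2; apply: HP.
Qed.

Lemma wp_test N F P X : P X (has (fun i => F (X i)) (iota 0 N)) -> wp N (test F) (pass_time N) P X.
Proof.
move=> HP; apply: (wp_pass (st := fun i => has (fun i => F (X i)) (iota 0 i))) => // i _.
by rewrite -addn1 iotaD has_cat /= orbF.
Qed.

Lemma wp_const N b P X : P X b -> wp N (const b) (pass_time N) P X.
Proof. by move=> HP; apply: (wp_pass (st := fun=> b)). Qed.

(** * Finding the row ends *)

Definition mark := ite (test (fun s => s tA && s tEnd))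
  (seqf (set_track tEnd (fun s => s tEnd || s tB)) (shift tC (fun s => s tC) true))
  (const true).

(** For width p the mark [tP] comes in at p - 1, the end of the first row, and is then shifted to p,
    the starting place of [tB]. The final test asks whether p is less than N %/ p, the length of the
    block of ones on [tC]. *)
Definition try_width :=
  seqf (set_track tEnd (fun s => s tP)) (
  seqf (shift tA (fun=> false) true) (
  seqf (shift tC (fun=> false) false) (
  seqf (shift tP (fun s => s tP) false) (
  seqf (set_track tB (fun s => s tP)) (
  seqf (search true (seqf mark (const false))
         (seqf (shift tA (fun s => s tA) false)
         (seqf (shift tB (fun s => s tB) false) (test (fun s => s tA)))))
  (test (fun s => s tP && s tC))))))).

(* Sets [tEnd] on the last cell of every row of the n x n matrix. The row width
   is the least p with (n * n) %/ p <= p; for each candidate p, the marks [tA]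
   and [tB] move rightwards at distance p, copying the row ends, and [tC] counts
   the row ends in unary. *)
Definition setup := seqf (shift tP (fun=> false) true) (search false try_width (const true)).

Section Setup.
Variables (N : nat) (w : seq bool).

Definition has_input X := forall i, i < N -> X i tIn = nth false w i.
Definition trk X t (g : nat -> bool) := forall i, i < N -> X i t = g i.

(** Before round [k] the row ends are marked up to, but not including, the position of [tB], and
    [tC] has counted those among the first [k] cells. *)
Definition copy_inv p k X := [/\ has_input X, trk X tP (fun i => i == p),
  trk X tA (fun i => i == k), trk X tB (fun i => i == k + p) &
  trk X tEnd (fun i => (p %| i.+1) && (i < k + p)) /\ trk X tC (fun i => i < k %/ p)].

Definition copy_inv' p k X := [/\ has_input X, trk X tP (fun i => i == p),
  trk X tA (fun i => i == k), trk X tB (fun i => i == k + p) &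
  trk X tEnd (fun i => (p %| i.+1) && (i < (k + p).+1)) /\ trk X tC (fun i => i < k.+1 %/ p)].

Lemma wp_mark p k X : 0 < p -> k < N -> copy_inv p k X ->
  wp N mark (pass_time N + (pass_time N + pass_time N)) (fun X' _ => copy_inv' p k X') X.
Proof.
move=> p0 lt_k [HI HP HA HB [HE HC]].
apply: wp_ite; apply: wp_test.
rewrite (@has_iota_eq _ N k (p %| k.+1)) => [|i lt_i]; last first.
  rewrite HA // HE //; case: eqP => //= ->.
  by rewrite -[X in X < _]addn0 ltn_add2l p0 andbT.
rewrite lt_k /=; case: ifP => dv.
  apply: wp_seq; apply: wp_set => X1 _ E1 O1.
  apply: wp_shift => X2 _ E2 O2.
  split; [move=> i lt_i|move=> i lt_i|move=> i lt_i|move=> i lt_i|split=> i lt_i];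
    rewrite ?E2 ?O2 // ?E1 ?O1 // ?HI ?HP ?HA ?HB ?HE //.
    rewrite ltnS [in RHS]leq_eqVlt; case: eqP => [->|_]; last by rewrite /= orbF.
    by rewrite /= orbT -addSn dvdn_addl ?dv.
  rewrite divnS // dv; case: i lt_i => [//|i] lt_i.
  by rewrite O1 // HC //; lia.
apply: (@wp_weaken _ N _ (pass_time N)); [apply: wp_const|lia|move=> X' b H; exact: H].
split=> //; split=> i lt_i; rewrite ?HE ?HC // ?divnS ?dv //.
rewrite ltnS [in RHS]leq_eqVlt; case: eqP => [->|_] //=.
by rewrite ltnn andbT andbF -addSn dvdn_addl ?dv.
Qed.

Definition copy_time := N * ((pass_time N + (pass_time N + pass_time N)) + pass_time N + (pass_time N + (pass_time N + pass_time N))).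
Definition width_time := pass_time N + (pass_time N + (pass_time N + (pass_time N + (pass_time N + (copy_time + pass_time N))))).

Definition width_pre q X := has_input X /\ trk X tP (fun i => i == q).
Definition width_post q X := [/\ has_input X, trk X tP (fun i => i == q.+1) &
  trk X tEnd (fun i => q.+1 %| i.+1)].

Lemma wp_try_width q X : 0 < N -> width_pre q X ->
  wp N try_width width_time (fun X' b => width_post q X' /\ b = (q.+1 < N %/ q.+1)) X.
Proof.
move=> N0 [HI HP]; set p := q.+1.
apply: wp_seq; apply: wp_set => X1 _ E1 O1.
apply: wp_seq; apply: wp_shift => X2 _ E2 O2.
apply: wp_seq; apply: wp_shift => X3 _ E3 O3.
apply: wp_seq; apply: wp_shift => X4 _ E4 O4.
apply: wp_seq; apply: wp_set => X5 _ E5 O5.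
have P4 i : i < N -> X4 i tP = (i == p).
  rewrite E4; case: i => [//|i] lt_i.
  by rewrite O3 // O2 // O1 // HP // ltnW.
have I0 : copy_inv p 0 X5.
  split=> [i lt_i|i lt_i|i lt_i|i lt_i|].
  - by rewrite O5 // O4 // O3 // O2 // O1 // HI.
  - by rewrite O5 // P4.
  - by rewrite O5 // O4 // O3 // E2; case: i lt_i.
  - by rewrite E5 P4.
  - split=> i lt_i; last by rewrite O5 // O4 // E3 div0n; case: i lt_i.
    rewrite O5 // O4 // O3 // O2 // E1 HP //.
    apply/eqP/andP=> [->|[dv]]; first by rewrite dvdnn /p.
    by rewrite add0n /p ltnS => le_i; move/(dvdn_leq (ltn0Sn i)): dv; rewrite /p; lia.
apply: wp_seq.
pose J' X' := width_post q X' /\ trk X' tC (fun i => i < N %/ p).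
have NE : N.-1.+1 = N by rewrite prednK.
(* The body always returns [false] under polarity [true], so this search is a plain loop; it ends
   when [tA] leaves the word, after [N] rounds. *)
have loop : wp N (search true (seqf mark (const false))
         (seqf (shift tA (fun s => s tA) false)
         (seqf (shift tB (fun s => s tB) false) (test (fun s => s tA)))))
    copy_time (fun X' _ => J' X') X5.
  rewrite /copy_time -{2}NE; apply: wp_weaken (leqnn _) _.
    apply: (wp_search (I := copy_inv p) (J := copy_inv' p) (res := fun=> false) (J' := J') _ _ I0).
      move=> k Y; rewrite -ltnS NE => lt_k Ik.
      apply: wp_seq; apply: wp_weaken (wp_mark (ltn0Sn q) lt_k Ik) (leqnn _) _ => Y' _ Ik'.
      exact: wp_const.
    move=> k Y; rewrite -ltnS NE => lt_k _ [{}HI {}HP HA HB [HE HC]].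
    apply: wp_seq; apply: wp_shift => Y1 _ F1 Q1.
    apply: wp_seq; apply: wp_shift => Y2 _ F2 Q2.
    apply: wp_test.
    have A2 i : i < N -> Y2 i tA = (i == k.+1).
      by move=> lt_i; rewrite Q2 // F1; case: i lt_i => [//|i] lt_i; rewrite HA // ltnW.
    have B2 i : i < N -> Y2 i tB = (i == k.+1 + p).
      by move=> lt_i; rewrite F2; case: i lt_i => [//|i] lt_i; rewrite Q1 // HB // ltnW.
    rewrite (@has_iota_eq _ N k.+1 true) => [|i lt_i]; last by rewrite A2 // andbT.
    rewrite andbT -{1 2}NE ltnS; split=> //.
    have I2 : has_input Y2 by move=> i lt_i; rewrite Q2 // Q1 // HI.
    have P2 : trk Y2 tP (fun i => i == p) by move=> i lt_i; rewrite Q2 // Q1 // HP.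
    have C2 : trk Y2 tC (fun i => i < k.+1 %/ p) by move=> i lt_i; rewrite Q2 // Q1 // HC.
    have E2' : trk Y2 tEnd (fun i => (p %| i.+1) && (i < (k + p).+1)).
      by move=> i lt_i; rewrite Q2 // Q1 // HE.
    case: ltnP => [lt_k'|ge_k]; first by split.
    have eN : k.+1 = N by lia.
    split; last by rewrite -eN.
    split=> // i lt_i; rewrite E2' //; case: dvdnP => //= _; lia.
  move=> X' [] /=; first by case=> k [].
  by case.
apply: wp_weaken loop (leqnn _) _ => X' _ [[HI' HP' HE'] HC'].
apply: wp_test; split; first by split.
rewrite (@has_iota_eq _ N p (p < N %/ p)) => [|i lt_i]; last first.
  by rewrite HP' // HC' //; case: eqP => [->|].
case: (ltnP p (N %/ p)) => // lt_p; last by rewrite andbF.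
by rewrite andbT (leq_trans lt_p) // leq_div.
Qed.

Definition setup_time := pass_time N + N * (width_time + pass_time N).

Lemma wp_setup n X : 0 < n -> N = n * n -> has_input X ->
  wp N setup setup_time
    (fun X' _ => has_input X' /\ trk X' tEnd (fun i => n %| i.+1)) X.
Proof.
move=> n0 eN HI; have N0 : 0 < N by rewrite eN muln_gt0 n0.
have nE : n.-1.+1 = n by rewrite prednK.
apply: wp_seq; apply: wp_shift => X1 _ E1 O1.
have I0 : width_pre 0 X1.
  split=> i lt_i; first by rewrite O1 // HI.
  by rewrite E1; case: i lt_i.
(* Since [N] is the square of [n], a width up to [n] is rejected exactly when it is smaller than
   [n]. *)
have stop q : q <= n.-1 -> (q.+1 < N %/ q.+1) = (q < n.-1).
  move=> le_q; rewrite eN; apply/idP/idP=> [|lt_q].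
    apply: contraTT; rewrite -!leqNgt => ge_q.
    by have -> : q.+1 = n by [lia]; rewrite mulnK.
  by rewrite leq_divRL //; have : q.+2 <= n by [lia]; nia.
have le_n : n.-1.+1 <= N by rewrite nE eN leq_pmull.
apply: wp_weaken (leq_mul le_n (leqnn _)) _.
  apply: (wp_search (I := width_pre) (J := width_post)
    (res := fun q => q.+1 < N %/ q.+1) (J' := fun=> True) _ _ I0).
    by move=> q Y _; apply: wp_try_width.
  move=> q Y le_q; rewrite stop //= => lt_q [HI' HP' _].
  by apply: wp_const; rewrite lt_q.
move=> X' [] /=; first by case=> /(_ _ (leqnn _)); rewrite stop // ltnn.
case=> q [le_q]; rewrite stop // => ge_q [HI' _ HE']; split=> //.
by have <- : q.+1 = n by lia.
Qed.
End Setup.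

(** * Quantifiers as nested loops *)

Section Quantifiers.
Variables (pol : nat -> bool) (phi : rel nat -> rel nat -> bool).

Definition atom : finType := (bool * 'I_m * 'I_m)%type.
(** Adjacency is read at the single cell where the row of variable [i] crosses the column of
    variable [j]; equality is witnessed by any cell lying in both rows. *)
Definition atom_test (a : atom) (s : cell) : bool :=
  let: (b, i, j) := a in
  if b then [&& s tIn, s (inr (i, true)) & s (inr (j, false))]
  else s (inr (i, true)) && s (inr (j, true)).

(** The state collects the atoms found true so far, so one sweep settles all of them. *)
Definition eval_matrix : frag cell :=
  pass (fun (q : {ffun atom -> bool}) s => [ffun a => q a || atom_test a s]) (fun _ s => s)
    (fun q => phi (fun a b => q (true, inord a, inord b)) (fun a b => q (false, inord a, inord b)))
    [ffun => false].

(** Column marks are dropped at row ends instead of wrapping into the next row; an empty column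
    track thus signals that the last vertex has been passed. *)
Fixpoint quant (r j : nat) : frag cell :=
  if r is r'.+1 then
    seqf (seqf (shift_rows (trow j) (fun=> false) true) (shift (tcol j) (fun s => s tEnd) true))
    (search (pol j) (quant r' j.+1)
      (seqf (shift_rows (trow j) (fun s => s (trow j)) false) (
       seqf (shift (tcol j) (fun s => s (tcol j) && ~~ s tEnd) false)
       (test (fun s => s (tcol j))))))
  else eval_matrix.

Fixpoint quant_time (N r : nat) : nat :=
  if r is r'.+1 then pass_time N + pass_time N + N * (quant_time N r' + (pass_time N + (pass_time N + pass_time N))) else pass_time N.

Section Semantics.
Variables (n' : nat).
Notation n := n'.+1.
Variable e : rel 'I_n.

Definition setv (v : nat -> 'I_n) j x : nat -> 'I_n := fun i => if i == j then x else v i.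

Fixpoint qeval (r j : nat) (v : nat -> 'I_n) : bool :=
  if r is r'.+1 then
    if pol j then [exists x, qeval r' j.+1 (setv v j x)]
    else [forall x, qeval r' j.+1 (setv v j x)]
  else phi (fun a b => e (v (inord a : 'I_m)) (v (inord b : 'I_m)))
           (fun a b => v (inord a : 'I_m) == v (inord b : 'I_m)).

Lemma qeval_ext r j v v' : j + r = m -> (forall i, i < j -> v i = v' i) ->
  qeval r j v = qeval r j v'.
Proof.
elim: r j v v' => [|r IH] j v v' ejr Hv /=.
  rewrite addn0 in ejr; subst j.
  have H a : v (inord a : 'I_m) = v' (inord a : 'I_m) by apply/Hv/ltn_ord.
  by congr (phi _ _); apply: functional_extensionality => a;
    apply: functional_extensionality => b; rewrite !H.
have H x : qeval r j.+1 (setv v j x) = qeval r j.+1 (setv v' j x).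
  apply: IH => [|i]; first by rewrite addSnnS.
  by rewrite /setv ltnS leq_eqVlt => /predU1P[->|lt_i]; rewrite ?eqxx // ltn_eqF // Hv.
by case: pol; [apply: eq_existsb | apply: eq_forallb].
Qed.

(** Turns a block of quantifiers into one quantification over assignments, the form used in
    [color_sentence]. *)
Lemma qeval_forall s r j v : j + s + r = m -> (forall i, j <= i < j + s -> ~~ pol i) ->
  qeval (s + r) j v <-> (forall v', (forall i, i < j -> v' i = v i) -> qeval r (j + s) v').
Proof.
elim: s j v => [|s IH] j v ejr Hp.
  rewrite addn0 /=; rewrite addn0 in ejr; split=> [H v' Hv|]; last by apply.
  by rewrite (qeval_ext (v' := v)).
rewrite /= (negPf (Hp j _)); last by rewrite leqnn /= addnS ltnS leq_addr.
have {}IH x : qeval (s + r) j.+1 x <->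
    forall v', (forall i, i < j.+1 -> v' i = x i) -> qeval r (j.+1 + s) v'.
  by apply: IH; [lia | move=> i Hi; apply: Hp; lia].
rewrite addnS -addSn; split=> [/forallP H v' Hv|H].
  have /IH := H (v' j); apply=> i; rewrite /setv ltnS leq_eqVlt => /predU1P[->|lt_i].
    by rewrite eqxx.
  by rewrite ltn_eqF // Hv.
apply/forallP=> x; apply/IH => v' Hv; apply: H => i lt_i.
by rewrite Hv; [rewrite /setv ltn_eqF | exact: ltnW].
Qed.

Lemma qeval_exists s r j v : j + s + r = m -> (forall i, j <= i < j + s -> pol i) ->
  qeval (s + r) j v <-> (exists2 v', forall i, i < j -> v' i = v i & qeval r (j + s) v').
Proof.
elim: s j v => [|s IH] j v ejr Hp.
  rewrite addn0 /=; rewrite addn0 in ejr; split=> [H|[v' Hv]]; first by exists v.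
  by rewrite (qeval_ext (v' := v)).
rewrite /= (Hp j _); last by rewrite leqnn /= addnS ltnS leq_addr.
have {}IH x : qeval (s + r) j.+1 x <->
    exists2 v', forall i, i < j.+1 -> v' i = x i & qeval r (j.+1 + s) v'.
  by apply: IH; [lia | move=> i Hi; apply: Hp; lia].
rewrite addnS -addSn; split=> [/existsP[x /IH[v' Hv H]]|[v' Hv H]].
  by exists v' => // i lt_i; rewrite Hv; [rewrite /setv ltn_eqF | exact: ltnW].
apply/existsP; exists (v' j); apply/IH; exists v' => // i.
rewrite /setv ltnS leq_eqVlt => /predU1P[->|lt_i]; first by rewrite eqxx.
by rewrite ltn_eqF // Hv.
Qed.

Variable N : nat.
Hypothesis eN : N = n * n.
Let w := encode_graph e.

(** Tracks of the variables from [j] on are arbitrary, so inner loops have nothing to clean up. *)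
Definition var_inv j (v : nat -> 'I_n) X :=
  [/\ has_input N w X, trk N X tEnd (fun i => n %| i.+1) &
   forall k, k < j -> trk N X (trow k) (fun i => i %/ n == v k) /\
                      trk N X (tcol k) (fun i => i %% n == v k)].

Lemma nth_encode (a b : 'I_n) : nth false w (a * n + b) = e a b.
Proof.
rewrite /w /encode_graph.
have H (s t : seq 'I_n) i j : i < size s -> j < size t ->
  nth false [seq e x y | x <- s, y <- t] (i * size t + j) = e (nth ord0 s i) (nth ord0 t j).
  elim: s i => [//|x s IH] [|i] /= lt_i lt_j; rewrite nth_cat size_map.
    by rewrite lt_j (nth_map ord0).
  by rewrite mulSn -addnA ltnNge leq_addr /= addKn IH.
have := H (enum 'I_n) (enum 'I_n) a b; rewrite size_enum_ord => -> //.
by rewrite !nth_ord_enum.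
Qed.

Lemma wp_eval v X : var_inv m v X ->
  wp N eval_matrix (pass_time N) (fun X' b => var_inv m v X' /\ b = qeval 0 m v) X.
Proof.
move=> Inv; have [HI HE Hv] := Inv.
pose st i : {ffun atom -> bool} := [ffun a => has (fun i => atom_test a (X i)) (iota 0 i)].
have HR (k : 'I_m) i : i < N -> X i (inr (k, true)) = (i %/ n == v k).
  by move=> lt_i; have [+ _] := Hv k (ltn_ord k) => /(_ i lt_i); rewrite /trow inord_val.
have HC (k : 'I_m) i : i < N -> X i (inr (k, false)) = (i %% n == v k).
  by move=> lt_i; have [_ +] := Hv k (ltn_ord k) => /(_ i lt_i); rewrite /tcol inord_val.
apply: (wp_pass (st := st)) => [|i _|].
- by apply/ffunP=> a; rewrite !ffunE.
- by apply/ffunP=> a; rewrite !ffunE -addn1 iotaD has_cat /= orbF.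
split=> //.
have -> : st N = [ffun a : atom => let: (b, i, j) := a in if b then e (v i) (v j) else v i == v j].
  apply/ffunP=> -[[b i] j]; rewrite !ffunE; case: b => /=.
    rewrite (@has_iota_eq _ N (v i * n + v j) (e (v i) (v j))) => [|k lt_k].
      by rewrite (_ : _ < N) // eN; have := ltn_ord (v i); have := ltn_ord (v j); nia.
    rewrite HR // HC // HI //; case: (k =P _) => [->|ne] /=.
      by rewrite nth_encode divnMDl // modnMDl divn_small // modn_small // addn0 !eqxx !andbT.
    apply/negbTE/negP=> /and3P[_ /eqP E1 /eqP E2]; apply: ne.
    by rewrite (divn_eq k n) E1 E2.
  apply/hasP/eqP=> [[k]|eqv].
    by rewrite mem_iota /= => lt_k; rewrite !HR // => /andP[/eqP-> /eqP/val_inj].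
  exists (v i * n); first by rewrite mem_iota /= eN ltn_pmul2r.
  by rewrite !HR ?mulnK ?eqv ?eqxx // eN ltn_pmul2r.
rewrite /=; congr (phi _ _); apply: functional_extensionality => a;
  apply: functional_extensionality => b; by rewrite ffunE.
Qed.

Lemma var_inv_le j v v' X : (forall i, i < j -> v' i = v i) -> var_inv j.+1 v' X -> var_inv j v X.
Proof.
move=> Hv [HI HE H]; split=> // k lt_k.
by have := H k (ltnW lt_k); rewrite Hv.
Qed.

Lemma trow_neq k j : k < j -> j < m -> trow k != trow j.
Proof.
move=> lt_k lt_j; rewrite /trow; apply/eqP=> -[/(congr1 val)] /=.
by rewrite !inordK ?(ltn_trans lt_k) // => kj; rewrite kj ltnn in lt_k.
Qed.

Lemma tcol_neq k j : k < j -> j < m -> tcol k != tcol j.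
Proof.
move=> lt_k lt_j; rewrite /tcol; apply/eqP=> -[/(congr1 val)] /=.
by rewrite !inordK ?(ltn_trans lt_k) // => kj; rewrite kj ltnn in lt_k.
Qed.

Lemma trow_tcol k j : trow k != tcol j.
Proof. by apply/eqP=> -[]. Qed.

Lemma tcol_trow k j : tcol k != trow j.
Proof. by apply/eqP=> -[]. Qed.

Lemma row_lt i : i < N -> i %/ n < n.
Proof. by rewrite eN ltn_divLR. Qed.

Lemma wp_next j v x X : j < m -> x < n -> var_inv j.+1 (setv v j (inord x)) X ->
  wp N (seqf (shift_rows (trow j) (fun s => s (trow j)) false) (
       seqf (shift (tcol j) (fun s => s (tcol j) && ~~ s tEnd) false)
       (test (fun s => s (tcol j))))) (pass_time N + (pass_time N + pass_time N))
   (fun X' b => b = (x < n') /\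
      if x < n' then var_inv j.+1 (setv v j (inord x.+1)) X' else var_inv j v X') X.
Proof.
move=> lt_j lt_x [HI HE Hv].
apply: wp_seq; apply: (wp_shift_rows (n := n)) => // X1 _ E1 O1.
apply: wp_seq; apply: wp_shift => X2 _ E2 O2; apply: wp_test.
have HI2 : has_input N w X2 by move=> i lt_i; rewrite O2 // O1 // HI.
have HE2 : trk N X2 tEnd (fun i => n %| i.+1) by move=> i lt_i; rewrite O2 // O1 // HE.
have [HR HC] := Hv j (ltnSn j); rewrite /setv eqxx inordK // in HR HC.
have R2 : trk N X2 (trow j) (fun i => i %/ n == x.+1).
  move=> i lt_i; rewrite O2 ?trow_tcol // E1; case D: (i %/ n) => [//|r0].
  have lt_r := row_lt lt_i; rewrite D in lt_r.
  have lt_q : (r0.+1 * n).-1 < N by rewrite eN; nia.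
  rewrite HR // (_ : _ %/ n = r0) // mulSnr addnS /= divnMDl // divn_small ?addn0 //.
(* For [x = n'] every column mark stands on a row end and disappears, whence the factor [x < n']. *)
have C2 : trk N X2 (tcol j) (fun i => (i %% n == x.+1) && (x < n')).
  move=> i lt_i; rewrite E2; case: i lt_i => [|i] lt_i; first by rewrite mod0n.
  rewrite !O1 ?tcol_trow // HC ?HE ?(ltnW lt_i) //.
  rewrite modnS; case: ifP => dv; first by rewrite andbF.
  rewrite andbT eqSS; case: eqP => //= Hx; apply/esym; rewrite -Hx.
  have : (i %% n).+1 != n.
    apply: contraFneq dv => E; rewrite (divn_eq i n) -addnS E dvdn_addl ?dvdnn //.
    exact: dvdn_mull.
  by have := ltn_pmod i (ltn0Sn n'); lia.
have old k : k < j -> trk N X2 (trow k) (fun i => i %/ n == v k) /\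
                      trk N X2 (tcol k) (fun i => i %% n == v k).
  move=> lt_k; have [HRk HCk] := Hv k (ltnW lt_k).
  rewrite /setv ltn_eqF // in HRk HCk.
  by split=> i lt_i; rewrite O2 ?O1 ?trow_neq ?tcol_neq ?trow_tcol ?tcol_trow // ?HRk ?HCk.
split.
  rewrite (_ : has _ _ = (x < n')) //.
  apply/hasP/idP=> [[i]|lt_x'].
    by rewrite mem_iota /= => lt_i; rewrite C2 // => /andP[].
  exists x.+1; first by rewrite mem_iota /= eN; nia.
  by rewrite C2 ?lt_x' ?andbT ?modn_small // eN; nia.
case: ifP => lt_x'; last by split.
split=> // k; rewrite ltnS leq_eqVlt => /predU1P[->|lt_k]; last first.
  by rewrite /setv ltn_eqF //; apply: old.
rewrite /setv eqxx inordK ?ltnS //; split=> [//|i lt_i].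
by rewrite C2 // lt_x' andbT.
Qed.

Lemma wp_first j v X : j < m -> var_inv j v X ->
  wp N (seqf (shift_rows (trow j) (fun=> false) true) (shift (tcol j) (fun s => s tEnd) true))
    (pass_time N + pass_time N) (fun X' _ => var_inv j.+1 (setv v j (inord 0)) X') X.
Proof.
move=> lt_j [HI HE Hv].
apply: wp_seq; apply: (wp_shift_rows (n := n)) => // X1 _ E1 O1.
apply: wp_shift => X2 _ E2 O2.
split=> [i lt_i|i lt_i|k]; rewrite ?O2 ?O1 ?HI ?HE //.
rewrite ltnS leq_eqVlt => /predU1P[->|lt_k].
  rewrite /setv eqxx inordK //; split=> i lt_i.
    by rewrite O2 ?trow_tcol // E1; case: (i %/ n).
  rewrite E2; case: i lt_i => [|i] lt_i; first by rewrite mod0n.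
  by rewrite O1 // HE ?(ltnW lt_i).
have [HRk HCk] := Hv k lt_k; rewrite /setv ltn_eqF //.
by split=> i lt_i; rewrite O2 ?O1 ?trow_neq ?tcol_neq ?trow_tcol ?tcol_trow // ?HRk ?HCk.
Qed.

Lemma wp_quant r j v X : j + r = m -> var_inv j v X ->
  wp N (quant r j) (quant_time N r) (fun X' b => var_inv j v X' /\ b = qeval r j v) X.
Proof.
elim: r j v X => [|r IH] j v X; first by rewrite addn0 => -> /wp_eval.
move=> ejr Inv; have lt_j : j < m by lia.
have agree x i : i < j -> setv v j x i = v i by move=> lt_i; rewrite /setv ltn_eqF.
apply: wp_seq; apply: wp_weaken (wp_first lt_j Inv) (leqnn _) _ => {Inv} {}X _ Inv.
have le_n : n <= N by rewrite eN leq_pmull.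
apply: wp_weaken (leq_mul le_n (leqnn _)) _.
  pose I x := var_inv j.+1 (setv v j (inord x)).
  apply: (wp_search (I := I) (J := I) (K := n') (J' := var_inv j v)
    (res := fun x => qeval r j.+1 (setv v j (inord x))) _ _ Inv).
    by move=> x Y _ HY; apply: IH => //; rewrite addSnnS.
  by move=> x Y le_x _ HY; apply: wp_next.
move=> X' b /=; case: eqP => [->|/eqP nb].
  case=> x [le_x Hx HX']; split; first exact: var_inv_le (agree _) HX'.
  case: (pol j) Hx => Hx; first by apply/esym/existsP; exists (inord x).
  by apply/esym/negbTE/forallPn; exists (inord x); rewrite Hx.
case=> Hx HX'; split=> //; have {nb} -> : b = ~~ pol j by move: nb; case: b; case: pol.
have {}Hx (x : 'I_n) : qeval r j.+1 (setv v j x) = ~~ pol j.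
  by rewrite -(Hx x) ?inord_val // -ltnS.
case: (pol j) Hx => /= Hx; apply/esym; last by apply/forallP.
by apply/negbTE/existsPn=> x; rewrite Hx.
Qed.

End Semantics.
End Quantifiers.
End Tracks.

(** * The decision procedure *)

Section Machine.
Variables (S : finType) (F : frag S) (inp : bool -> S).

Definition TM_of : TM :=
  @Build_TM (fstate F + bool)%type (option S) None (fun b => Some (inp b))
    (inl (fentry F)) (inr true) (inr false)
    (fun q h => match q with inl q' => fdelta q' h | inr b => (inr b, h, Stay) end).

Definition config_of (q : fstate F + bool) (tp : tape S) : config TM_of :=
  let: (l, h, r) := tp in (q, l, h, r).

Lemma runs_iter q tp t q2 tp2 : @runs S F q tp t q2 tp2 ->
  iter t (@tm_step TM_of) (config_of q tp) = config_of q2 tp2.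
Proof.
elim=> // {}q l h r q' s mv {}t q3 tp3 E _ IH; rewrite iterSr -IH; congr iter.
by rewrite /= E; case: mv {E IH} => //=; [case: l | case: r].
Qed.

Lemma result_decides w T tp b (P : Prop) t :
  result F (rtape [::] (map (fun b => Some (inp b)) w)) T tp b -> T <= t -> (b <-> P) ->
  decides_within TM_of w t P.
Proof.
case=> t0 le_t0 /runs_iter r le_T HP; rewrite /decides_within.
have -> : init_config TM_of w = config_of (inl (fentry F)) (rtape [::] (map (fun b => Some (inp b)) w)).
  by case: w {r}.
rewrite -(subnK (leq_trans le_t0 le_T)) iterD r.
(* Halting configurations are fixed, so the run may be padded to the full bound [t]. *)
have -> k : iter k (@tm_step TM_of) (config_of (inr b) tp) = config_of (inr b) tp.
  by elim: k => //= k ->; case: tp {r} => -[l h] r0; case: b HP.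
by case: tp {r} => -[l h] r0; rewrite /= /halted; case: b HP => HP; rewrite ?eqxx.
Qed.
End Machine.

Lemma color_matrix_ext (E E' Q Q' : rel nat) :
  (forall a b, a < 16 -> b < 16 -> E a b = E' a b) ->
  (forall a b, a < 16 -> b < 16 -> Q a b = Q' a b) ->
  color_matrix E Q = color_matrix E' Q'.
Proof.
move=> HE HQ; rewrite /color_matrix /var_dominated /var_color /first_of4 /=.
by rewrite !HE // !HQ.
Qed.

Definition color_pol (i : nat) := 0 < i < 13.

(** The 16 quantifiers split into blocks of 1, 12 and 3. *)
Lemma qeval_color_sentence n' (e : rel 'I_n'.+1) v :
  qeval 15 color_pol color_matrix e 16 0 v <-> color_sentence e.
Proof.
have last_eq v2 : qeval 15 color_pol color_matrix e 0 16 v2 = matrix_at e v2.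
  by rewrite /=; apply: color_matrix_ext => a b lt_a lt_b; rewrite !inordK.
have blk3 v1 : qeval 15 color_pol color_matrix e 3 13 v1 <->
    forall v2, (forall i, i < 13 -> v2 i = v1 i) -> matrix_at e v2.
  have := @qeval_forall 15 color_pol color_matrix n' e 3 0 13 v1 erefl.
  rewrite addn0 => ->; last by move=> i; rewrite /color_pol; lia.
  by split=> H v2 /H; rewrite last_eq.
have blk2 v1 := @qeval_exists 15 color_pol color_matrix n' e 12 3 1 v1 erefl.
have blk1 := @qeval_forall 15 color_pol color_matrix n' e 1 15 0 v erefl.
rewrite -[16]/(1 + 15) blk1; last by move=> i; rewrite /color_pol; lia.
split=> H v1.
  have /blk2[|v2 Hv2 /blk3 H2] : qeval 15 color_pol color_matrix e 15 1 v1 by apply: H.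
    by move=> i; rewrite /color_pol; lia.
  by exists v2; first exact: Hv2.
move=> _; apply/blk2; first by move=> i; rewrite /color_pol; lia.
have [v2 v20 H2] := H v1; exists v2; first by case.
exact/blk3.
Qed.

(** * Polynomial bounds on the running times *)

Definition poly_bounded (f : nat -> nat) := exists c k, forall N, f N <= c * N.+1 ^ k.

Lemma poly_const c : poly_bounded (fun=> c).
Proof. by exists c, 0 => N; rewrite expn0 muln1. Qed.

Lemma poly_id : poly_bounded id.
Proof. by exists 1, 1 => N; rewrite expn1 mul1n leqnSn. Qed.

Lemma poly_add f g : poly_bounded f -> poly_bounded g -> poly_bounded (fun N => f N + g N).
Proof.
move=> [c [k Hf]] [c' [k' Hg]]; exists (c + c'), (k + k') => N.
rewrite mulnDl leq_add //.
  by rewrite (leq_trans (Hf N)) // leq_mul2l leq_pexp2l ?leq_addr ?orbT.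
by rewrite (leq_trans (Hg N)) // leq_mul2l leq_pexp2l ?leq_addl ?orbT.
Qed.

Lemma poly_mul f g : poly_bounded f -> poly_bounded g -> poly_bounded (fun N => f N * g N).
Proof.
move=> [c [k Hf]] [c' [k' Hg]]; exists (c * c'), (k + k') => N.
by rewrite expnD mulnACA leq_mul.
Qed.


Lemma poly_pass_time : poly_bounded pass_time.
Proof. exact: poly_add (poly_mul (poly_const 2) poly_id) (poly_const 3). Qed.

Lemma poly_setup : poly_bounded setup_time.
Proof.
have p := poly_pass_time; have pN := poly_id.
have pc : poly_bounded copy_time.
  by apply: poly_mul pN _; do ![apply: poly_add => //].
have pw : poly_bounded width_time.
  by do 5![apply: (poly_add poly_pass_time)]; apply: poly_add.
by apply: (poly_add p (poly_mul pN _)); apply: poly_add.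
Qed.

Lemma poly_quant r : poly_bounded (quant_time^~ r).
Proof.
have p := poly_pass_time; elim: r => [|r IH] //=.
apply: poly_add; first exact: poly_add.
by apply: poly_mul poly_id _; do ![apply: poly_add => //].
Qed.

Definition input_cell m' (b : bool) : cell m' := [ffun t => (t == tIn m') && b].

(** The test fails only on the empty word, which codes the graph without vertices and is accepted at
    once. *)
Definition prenex_program m' pol phi : frag (cell m') :=
  seqf (startup (fun b _ => b) (fun _ s => s) id false)
    (ite (test (fun=> true)) (seqf (setup m') (quant m' pol phi m'.+1 0)) (const m' true)).

Definition prenex_TM m' pol phi := TM_of (prenex_program m' pol phi) (@input_cell m').

Lemma wf_prenex_TM m' pol phi : wf_TM (prenex_TM m' pol phi).
Proof.
split=> [b b' [/ffunP/(_ (tIn m'))]|]; last by split.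
by rewrite !ffunE eqxx.
Qed.

(** Truth on the empty vertex set fits a sentence that begins with a universal quantifier. *)
Definition prenex_holds m' pol phi n : rel 'I_n -> Prop :=
  if n is n'.+1 then fun e => qeval m' pol phi e m'.+1 0 (fun=> ord0) else fun=> True.

Lemma prenex_TM_decides m' pol phi : exists c k, forall n (e : rel 'I_n),
  decides_within (prenex_TM m' pol phi) (encode_graph e) (c * (size (encode_graph e)).+1 ^ k)
    (prenex_holds m' pol phi e).
Proof.
have [c [k Hck]] : poly_bounded (fun N => pass_time N + (pass_time N + (setup_time N + quant_time N m'.+1))).
  have p := poly_pass_time; apply: (poly_add p (poly_add p (poly_add poly_setup _))).
  exact: poly_quant.
exists c, k => n e; set w := encode_graph e; set P := prenex_holds _ _ _ _.
have sw : size w = n * n by rewrite /w size_allpairs size_enum_ord.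
pose X0 i := input_cell m' (nth false w i).
have init : map (fun b => Some (input_cell m' b)) w = map Some (mkseq X0 (size w)).
  rewrite -[in LHS](mkseq_nth false w) /mkseq -!map_comp.
  exact: eq_map.
have {}Hck := Hck (size w).
suff [X' [b [Hr Hb]]] : exists X' b, result (prenex_program m' pol phi)
    (rtape [::] (map Some (mkseq X0 (size w))))
    (pass_time (size w) + (pass_time (size w) + (setup_time (size w) + quant_time (size w) m'.+1)))
    (canon (mkseq X' (size w))) b /\ (b <-> P).
  by apply: (result_decides _ Hck Hb); rewrite init; apply: Hr.
have Hst := @result_startup _ _ (fun b (_ : cell m') => b) (fun _ s => s) id false _ _ _
  (@mealyE _ _ (fun b (_ : cell m') => b) (fun _ s => s) X0 (fun=> false) (size w) (fun _ _ => erefl)).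
rewrite size_mkseq in Hst.
suff [X' [b [Hr Hb]]] : wp (size w) (ite (test (fun=> true)) (seqf (setup m') (quant m' pol phi m'.+1 0)) (const m' true))
    (pass_time (size w) + (setup_time (size w) + quant_time (size w) m'.+1)) (fun _ b => b <-> P) X0.
  by exists X', b; split=> //; apply: result_ite Hst Hr.
apply: wp_ite; apply: wp_test; rewrite has_predT size_iota.
clear Hck Hst init; case: n => [|n'] in e w P sw X0 *.
  have -> : (0 < size w) = false by rewrite sw.
  apply: (@wp_weaken _ _ _ (pass_time (size w)) _ (fun _ b => b <-> P)) => //.
    by apply: wp_const.
  by rewrite /setup_time -addnA leq_addr.
have -> : (0 < size w) = true by rewrite sw.
apply: wp_seq.
have HI : has_input (size w) w X0 by move=> i lt_i; rewrite ffunE eqxx.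
apply: wp_weaken (wp_setup (ltn0Sn n') sw HI) (leqnn _) _ => X1 _ [HI1 HE1].
have Inv : var_inv e (size w) 0 (fun=> ord0) X1 by split.
by apply: wp_weaken (wp_quant pol phi sw (add0n _) Inv) (leqnn _) _ => X2 b [_ ->].
Qed.

Theorem theorem4 :
  exists (M : TM) (c k : nat), wf_TM M /\
    forall (n : nat) (e : rel 'I_n),
      simple_graph e -> P5_free e ->
      decides_within M (encode_graph e) (c * (size (encode_graph e)).+1 ^ k)
        (has_bipartizing_matching e).
Proof.
have [c [k H]] := prenex_TM_decides 15 color_pol color_matrix.
exists (prenex_TM 15 color_pol color_matrix), c, k; split; first exact: wf_prenex_TM.
move=> n e sg P5f; have := H n e; rewrite /decides_within.
have E : prenex_holds 15 color_pol color_matrix e <-> has_bipartizing_matching e.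
  rewrite -color_sentenceP //; case: n e {sg P5f} => [|n] e; last exact: qeval_color_sentence.
  (* Without vertices there is no assignment, so the sentence holds vacuously. *)
  by split=> // _ v; case: (v 0).
by case: (iter _ _ _) => [[[q l] h] r] [hq qP]; split=> //; rewrite qP.
Qed.
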